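(* Let $G$ be a graph on $n$ vertices without isolated vertices. Then $\operatorname{pd}(G)\le n-\tau(G)$.
   Context: All graphs are finite and simple. For $X\subseteq V(G)$, $N(X)$ is the union of neighborhoods of vertices of $X$, and $\gamma_0(X,G)$ is the minimum cardinality of a set $A\subseteq V(G)$ with $X\subseteq N(A)$ (allowing $A\cap X\ne\emptyset$). $\tau(G)=\max\{\gamma_0(A,G):A\subseteq V(G)\text{ independent}\}$. For $G$ with vertex set $\{x_1,\dots,x_n\}$ and a fixed field $\mathbf{k}$, $S=\mathbf{k}[x_1,\dots,x_n]$, $I(G)$ is the edge ideal generated by $x_ix_j$ over edges $(x_i,x_j)$, and $\operatorname{pd}(G)$ is the projective dimension of $S/I(G)$. *)

(* Defs.v *)
From HB Require Import structures.
From mathcomp Require Import all_boot all_order all_algebra.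
From mathcomp Require Import mpoly.
Set Implicit Arguments. Unset Strict Implicit. Unset Printing Implicit Defensive.
Import GRing.Theory.
Local Open Scope ring_scope.

(* Graphs on vertex set 'I_n (vertex i <-> variable x_i = 'X_i),
   given by an adjacency relation e : rel 'I_n. *)
Definition simple_graph (n : nat) (e : rel 'I_n) : Prop :=
  (forall u v, e u v = e v u) /\ (forall v, ~~ e v v).

Definition no_isolated (n : nat) (e : rel 'I_n) : Prop :=
  forall v, exists u, e v u.

Definition nbhd (n : nat) (e : rel 'I_n) (X : {set 'I_n}) : {set 'I_n} :=
  [set u | [exists x in X, e x u]].

Definition independent (n : nat) (e : rel 'I_n) (A : {set 'I_n}) : bool :=
  [forall x in A, forall y in A, ~~ e x y].

(* gamma_0(X,G) = min |A| with X \subset N(A).  (The default #|V| is never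
   attained spuriously when G has no isolated vertices, since then A = V works.) *)
Definition gamma0 (n : nat) (e : rel 'I_n) (X : {set 'I_n}) : nat :=
  \big[minn/#|'I_n|]_(A : {set 'I_n} | X \subset nbhd e A) #|A|.

Definition tau (n : nat) (e : rel 'I_n) : nat :=
  \max_(A : {set 'I_n} | independent e A) gamma0 e A.

Definition in_edge_ideal (k : fieldType) (n : nat) (e : rel 'I_n)
    (f : {mpoly k[n]}) : Prop :=
  exists c : 'I_n -> 'I_n -> {mpoly k[n]},
    f = \sum_(i < n) \sum_(j < n | e i j) c i j * 'X_i * 'X_j.

(* A free resolution of S/I(G) of length at most m:
     0 <- S/I <- S <-d0- S^(b 0) <-(d 0)- S^(b 1) <-(d 1)- S^(b 2) <- ...
   with F_0 = S, F_(i+1) = S^(b i), F_j = 0 for j > m,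
   image d0 = I(G), and exactness at every F_j, j >= 1. *)
Definition free_res_of_length_le (k : fieldType) (n : nat) (e : rel 'I_n)
    (m : nat) : Prop :=
  exists (b : nat -> nat) (d0 : 'M[{mpoly k[n]}]_(1, b 0%N))
         (d : forall i : nat, 'M[{mpoly k[n]}]_(b i, b i.+1)),
    [/\ forall i, (m <= i)%N -> b i = 0%N,
        forall f : {mpoly k[n]},
          in_edge_ideal e f <-> exists y : 'cV_(b 0%N), d0 *m y = f%:M,
        forall x : 'cV[{mpoly k[n]}]_(b 0%N),
          d0 *m x = 0 <-> exists y, d 0%N *m y = x
      & forall i (x : 'cV[{mpoly k[n]}]_(b i.+1)),
          d i *m x = 0 <-> exists y, d i.+1 *m y = x].

(* pd(G) <= m : the projective dimension of S/I(G) is at most m, i.e.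
   S/I(G) admits a (finite free) resolution of length at most m. *)
Definition pd_le (k : fieldType) (n : nat) (e : rel 'I_n) (m : nat) : Prop :=
  free_res_of_length_le k e m.

(* Main.v *)
(* Fix an independent set A. By induction on |W|, for every vertex set W there
   is a set D dominating the part of A inside W such that the ideal I_W of the
   induced subgraph satisfies pd(S/I_W) + |D| <= |W|. If W is contained in A
   then I_W = 0 and D picks a neighbour of each vertex of W. Otherwise choose x
   in W \ A and split I_W = K + x J, where K = I_(W \ x) and J = K + (N(x)), so
   that pd(S/I_W) <= max(pd(S/K) + 1, pd(S/J)). Since x is not in A, the set
   obtained for W \ x still dominates; and the vertices of A lost on passing to
   W \ N[x] are dominated by x, while the variables of N(x) raise pd(S/J) by at
   most |N(x)|. *)

Require Import Defs.
From mathcomp Require Import all_boot all_order all_algebra.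
From mathcomp Require Import mpoly.

Set Implicit Arguments. Unset Strict Implicit. Unset Printing Implicit Defensive.
Import GRing.Theory.
Local Open Scope ring_scope.

(** * Finite free resolutions of submodules of free modules *)

Section FreeResolutions.
Variable R : comNzRingType.

(* Indexed by the number of free modules in a resolution of [M], so that for an
   ideal [I] the bound reads [pd(R/I) <= m], not [pd(I) <= m]. *)
Fixpoint free_res (m p : nat) (M : 'cV[R]_p -> Prop) : Prop :=
  if m is m'.+1 then
    exists q (A : 'M[R]_(p, q)),
      (forall x, M x <-> exists y, A *m y = x) /\
      free_res m' (fun y : 'cV[R]_q => A *m y = 0)
  else forall x, M x <-> x = 0.

Lemma free_res_ext m p (M N : 'cV[R]_p -> Prop) :
  (forall x, M x <-> N x) -> free_res m M -> free_res m N.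
Proof.
case: m => [|m] eMN /=; first by move=> M0 x; rewrite -eMN.
by case=> q [A [imA resA]]; exists q, A; split=> // x; rewrite -eMN.
Qed.

Lemma free_res_zero m p : free_res m (fun x : 'cV[R]_p => x = 0).
Proof.
elim: m p => [|m IHm] p //=; exists 0%N, 0; split.
  by move=> x; split=> [->|[y <-]]; [exists 0; rewrite mul0mx | rewrite mul0mx].
apply: free_res_ext (IHm 0%N) => y; split=> _; first by rewrite mul0mx.
by apply/matrixP=> -[].
Qed.

Lemma free_resS m p (M : 'cV[R]_p -> Prop) : free_res m M -> free_res m.+1 M.
Proof.
elim: m p M => [|m IHm] p M.
  by move=> M0; apply: free_res_ext (free_res_zero 1 p) => x; rewrite M0.
by case=> q [A [imA /IHm resA]]; exists q, A.
Qed.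

Lemma free_res_leq m1 m2 p (M : 'cV[R]_p -> Prop) :
  (m1 <= m2)%N -> free_res m1 M -> free_res m2 M.
Proof.
move=> /subnK <-; elim: (m2 - m1)%N => [|d IHd] //= resM.
by apply: free_resS; apply: IHd.
Qed.

(** Only the first map changes, from [A] to [E *m A]; injectivity of [E] keeps its kernel, so the
    rest of the resolution is reused. *)
Lemma free_res_inj m p q (E : 'M[R]_(q, p)) (M : 'cV[R]_p -> Prop) :
    (forall x : 'cV[R]_p, E *m x = 0 -> x = 0) -> free_res m M ->
  free_res m (fun y : 'cV[R]_q => exists2 x, M x & E *m x = y).
Proof.
move=> injE; case: m => [|m] /=.
  move=> M0 y; split=> [[x /M0 -> <-]|->]; first by rewrite mulmx0.
  by exists 0; [apply/M0 | rewrite mulmx0].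
case=> s [A [imA resA]]; exists s, (E *m A); split=> [y|].
  split=> [[x /imA [z <-] <-]|[z <-]]; first by exists z; rewrite mulmxA.
  by exists (A *m z); [apply/imA; exists z | rewrite mulmxA].
apply: free_res_ext resA => z; rewrite -mulmxA; split=> [->|/injE //].
by rewrite mulmx0.
Qed.

(* Horseshoe lemma for [0 -> M :&: ker g -> M -> g(M) -> 0]. *)
Lemma free_res_horseshoe m p r (M : 'cV[R]_p -> Prop) (g : 'M[R]_(r, p)) :
    (forall x y, M x -> M y -> M (x + y)) ->
    (forall a x, M x -> M (a *: x)) -> M 0 ->
    free_res m (fun x => M x /\ g *m x = 0) ->
    free_res m (fun z : 'cV[R]_r => exists2 x, M x & g *m x = z) ->
  free_res m M.
Proof.
elim: m p r M g => [|m IHm] p r M g MD MZ M0 /=.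
  move=> L0 N0 x; split=> [Mx|-> //].
  by apply/L0; split=> //; apply/N0; exists x.
case=> q [A [imA resA]] [s [B [imB resB]]].
(* Freeness: the columns of [B] lift along [g] to elements of [M], which form the columns of [C]. *)
have /fin_all_exists2[c Mc gc] (j : 'I_s) : exists2 x, M x & g *m x = col j B.
  by apply/imB; exists (delta_mx j 0); rewrite colE.
pose C : 'M[R]_(p, s) := \matrix_(i, j) c j i 0.
have colC j : col j C = c j.
  by apply/colP=> i; rewrite !mxE.
have gC : g *m C = B.
  apply/matrixP=> i j; have /colP/(_ i) := gc j; rewrite -colC !mxE => <-.
  by apply: eq_bigr => l _; rewrite !mxE.
have MC y : M (C *m y).
  have -> : C *m y = \sum_j y j 0 *: c j.
    apply/colP=> i; rewrite summxE !mxE; apply: eq_bigr => j _.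
    by rewrite !mxE mulrC.
  by apply: (big_ind M) => // j _; apply: MZ.
have MA y : M (A *m y) /\ g *m (A *m y) = 0 by apply/imA; exists y.
exists (q + s)%N, (row_mx A C); split=> [x|].
  split=> [Mx|[y <-]]; last first.
    by rewrite -[y]vsubmxK mul_row_col; apply: MD => //; case: (MA (usubmx y)).
  have [y By] : exists y, B *m y = g *m x by apply/imB; exists x.
  have [z Az] : exists z, A *m z = x - C *m y.
    apply/imA; split; last by rewrite mulmxBr mulmxA gC By subrr.
    by apply: MD => //; rewrite -scaleN1r; apply: MZ.
  by exists (col_mx z y); rewrite mul_row_col Az subrK.
have kerAC (y : 'cV[R]_(q + s)) :
    row_mx A C *m y = A *m usubmx y + C *m dsubmx y.
  by rewrite -{1}[y]vsubmxK mul_row_col.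
(* Induct on the syzygies of [row_mx A C], projected to the second block: the kernel is a copy of
   [ker A], the image is [ker B]. *)
apply: (IHm _ _ _ (row_mx 0 1%:M)).
- by move=> x y Ex Ey; rewrite mulmxDr Ex Ey addr0.
- by move=> a x Ex; rewrite -scalemxAr Ex scaler0.
- by rewrite mulmx0.
- have injE (x : 'cV[R]_q) : (col_mx 1%:M 0 : 'M_(q + s, q)) *m x = 0 -> x = 0.
    rewrite mul_col_mx mul1mx mul0mx -[0 in RHS](@col_mx0 R q s).
    by case/eq_col_mx.
  apply: free_res_ext (free_res_inj injE resA) => y; split.
    case=> x Ax <-; rewrite mul_col_mx mul1mx mul0mx !mul_row_col.
    by rewrite Ax !mulmx0 mul0mx !addr0.
  case=> Ey; rewrite -{1}[y]vsubmxK mul_row_col mul0mx mul1mx add0r => y0.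
  exists (usubmx y); last by rewrite mul_col_mx mul1mx mul0mx -y0 vsubmxK.
  by move: Ey; rewrite kerAC y0 mulmx0 addr0.
apply: free_res_ext resB => v; split=> [Bv|[y]].
  (* For [v] in [ker B], the vector [C *m v] lies in [M] and in [ker g], so [A] reaches it. *)
  have [z Az] : exists z, A *m z = - (C *m v).
    apply/imA; split; last by rewrite mulmxN mulmxA gC Bv oppr0.
    by rewrite -scaleN1r; apply: MZ.
  exists (col_mx z v); first by rewrite mul_row_col Az addNr.
  by rewrite mul_row_col mul0mx mul1mx add0r.
rewrite -{2}[y]vsubmxK mul_row_col mul0mx mul1mx add0r => + <-.
rewrite kerAC => /(congr1 (mulmx g)); rewrite mulmx0 mulmxDr [g *m (C *m _)]mulmxA gC.
by case: (MA (usubmx y)) => _ ->; rewrite add0r.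
Qed.

Definition ideal_res m (I : R -> Prop) : Prop :=
  free_res m (fun x : 'cV[R]_1 => I (x 0 0)).

Definition is_ideal (I : R -> Prop) : Prop :=
  [/\ I 0, forall a b, I a -> I b -> I (a + b) & forall a b, I b -> I (a * b)].

Lemma ideal_res_unit : ideal_res 1 (fun _ => True).
Proof.
exists 1%N, 1%:M; split=> [x|]; first by split=> // _; exists x; rewrite mul1mx.
by move=> x; rewrite mul1mx.
Qed.

(* The kernel of [F_K (+) F_J -> K + x J] maps onto [K], via the component in
   [F_J], with kernel the direct sum of the two syzygy modules: this is the
   mapping cone of [0 -> K -> K (+) J -> K + x J -> 0]. *)
Lemma ideal_res_split m (x : R) (K J I : R -> Prop) :
    is_ideal K -> is_ideal J -> (forall f, K f -> J f) ->
    (forall f, K (x * f) -> K f) ->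
    (forall f, I f <-> exists2 a, K a & exists2 b, J b & f = a + x * b) ->
  ideal_res m K -> ideal_res m.+1 J -> ideal_res m.+1 I.
Proof.
move=> [K0 KD KM] [J0 JD JM] sKJ Kx Idef resK.
(* [resK] serves twice: padded by one, it gives generators [A] of [K] whose syzygies have length
   [m]; unpadded, it resolves [K] as the image in the outer horseshoe. *)
have [q [A [/= imA resA]]] := free_resS resK.
case=> s [B [/= imB resB]].
have KA (y : 'cV[R]_q) : K ((A *m y) 0 0) by apply/imA; exists y.
have JB (y : 'cV[R]_s) : J ((B *m y) 0 0) by apply/imB; exists y.
exists (q + s)%N, (row_mx A (x *: B)); split=> [z|].
  split=> [/Idef[a Ka [b Jb Ez]]|[y <-]].
    have [u Au] : exists u, A *m u = a%:M by apply/imA; rewrite mxE mulr1n.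
    have [v Bv] : exists v, B *m v = b%:M by apply/imB; rewrite mxE mulr1n.
    exists (col_mx u v); rewrite mul_row_col -scalemxAl Au Bv.
    by apply/matrixP=> i j; rewrite !ord1 !mxE Ez !mulr1n.
  apply/Idef; exists ((A *m usubmx y) 0 0) => //.
  exists ((B *m dsubmx y) 0 0) => //.
  by rewrite -{1}[y]vsubmxK mul_row_col -scalemxAl mxE; congr (_ + _); rewrite mxE.
have kerE (y : 'cV[R]_(q + s)) :
    row_mx A (x *: B) *m y = A *m usubmx y + x *: (B *m dsubmx y).
  by rewrite -{1}[y]vsubmxK mul_row_col scalemxAl.
have gE (y : 'cV[R]_(q + s)) : row_mx 0 B *m y = B *m dsubmx y.
  by rewrite -{1}[y]vsubmxK mul_row_col mul0mx add0r.
have hE (y : 'cV[R]_(q + s)) : row_mx 0 1%:M *m y = dsubmx y.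
  by rewrite -{1}[y]vsubmxK mul_row_col mul0mx mul1mx add0r.
apply: (free_res_horseshoe (g := row_mx 0 B)).
- by move=> y z Ey Ez; rewrite mulmxDr Ey Ez addr0.
- by move=> a y Ey; rewrite -scalemxAr Ey scaler0.
- by rewrite mulmx0.
- apply: (@free_res_ext _ _ (fun y => A *m usubmx y = 0 /\ B *m dsubmx y = 0)).
    move=> y; rewrite gE kerE; split=> -[]; first by move=> -> ->; rewrite scaler0 addr0.
    by move=> + Ey; rewrite Ey scaler0 addr0.
  (* A second horseshoe resolves the direct sum of [ker A] and [ker B]. *)
  apply: (free_res_horseshoe (g := row_mx 0 1%:M)).
  + by move=> y z [Ey Fy] [Ez Fz]; rewrite !linearD /= Ey Fy Ez Fz !addr0.
  + by move=> a y [Ey Fy]; rewrite !linearZ /= Ey Fy !scaler0.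
  + by rewrite !linear0.
  + have injE (z : 'cV[R]_q) : (col_mx 1%:M 0 : 'M_(q + s, q)) *m z = 0 -> z = 0.
      rewrite mul_col_mx mul1mx mul0mx -[0 in RHS](@col_mx0 R q s).
      by case/eq_col_mx.
    apply: free_res_ext (free_res_inj injE resA) => y; rewrite hE; split.
      by case=> z Az <-; rewrite mul_col_mx mul1mx mul0mx col_mxKu col_mxKd mulmx0.
    case=> -[Ay _] y0; exists (usubmx y) => //.
    by rewrite mul_col_mx mul1mx mul0mx -y0 vsubmxK.
  apply: free_res_ext resB => v; split=> [Bv|[y [_ By]]]; last by rewrite hE => <-.
  by exists (col_mx 0 v); rewrite ?hE ?col_mxKu ?col_mxKd ?mulmx0.
(* The image is exactly [K]: an element [z] of [K] is hit because [z] lies in [J] and [- x * z] in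
   [K]; conversely a syzygy puts [x * (B v)] in [K], and [x] is a nonzerodivisor modulo [K]. *)
apply: free_res_ext resK => z; split=> [Kz|[y]].
  have [v Bv] : exists v, B *m v = z by apply/imB; apply: sKJ.
  have [u Au] : exists u, A *m u = - x *: z by apply/imA; rewrite mxE; apply: KM.
  exists (col_mx u v); last by rewrite gE col_mxKd.
  by rewrite kerE col_mxKu col_mxKd Au Bv scaleNr addNr.
rewrite kerE gE => Ey <-; apply: Kx.
have -> : x * (B *m dsubmx y) 0 0 = (-1) * (A *m usubmx y) 0 0.
  move/matrixP/(_ 0 0): Ey; rewrite !mxE => /eqP.
  by rewrite addr_eq0 mulN1r => /eqP ->; rewrite opprK.
exact: KM.
Qed.

(** Unrolls the recursion into one infinite sequence, padded with zero modules; each step puts a new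
    module in front and shifts the indices. *)
Lemma free_res_chain m p (M : 'cV[R]_p -> Prop) : free_res m M ->
  exists (b : nat -> nat) (d0 : 'M[R]_(p, b 0%N))
         (d : forall i : nat, 'M[R]_(b i, b i.+1)),
    [/\ forall i, (m <= i)%N -> b i = 0%N,
        forall x, M x <-> exists y, d0 *m y = x,
        forall x : 'cV[R]_(b 0%N), d0 *m x = 0 <-> exists y, d 0%N *m y = x
      & forall i (x : 'cV[R]_(b i.+1)),
          d i *m x = 0 <-> exists y, d i.+1 *m y = x].
Proof.
elim: m p M => [|m IHm] p M /=.
  move=> M0; exists (fun _ => 0%N), 0, (fun _ => 0).
  have triv (x : 'cV[R]_0) : x = 0 by apply/matrixP=> -[].
  split=> // [x|x|_ x]; last 2 first.
  - by split=> _; [exists 0; rewrite [RHS]triv mul0mx | rewrite mul0mx].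
  - by split=> _; [exists 0; rewrite [RHS]triv mul0mx | rewrite mul0mx].
  by split=> [/M0 ->|[y <-]]; [exists 0; rewrite mul0mx | apply/M0; rewrite mul0mx].
case=> q [A [imA /IHm[b [d0 [d [b0 im0 ex0 exd]]]]]].
pose b' i := if i is j.+1 then b j else q.
pose d' i : 'M[R]_(b' i, b' i.+1) :=
  match i return 'M[R]_(b' i, b' i.+1) with 0%N => d0 | j.+1 => d j end.
exists b', A, d'; split=> //; first by case=> // i; apply: b0.
by case.
Qed.

End FreeResolutions.

(** * Monomial ideals, described by exponents *)

Section MonomialIdeals.
Variables (k : fieldType) (n : nat).
Implicit Types (b : pred 'X_{1..n}) (f : {mpoly k[n]}).

(** The span of the monomials selected by [b], an ideal once [b] is up-closed; membership is tested
    term by term, without generators. *)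
Definition monideal b f : Prop := forall m, m \in msupp f -> b m.

Definition upclosed b : Prop := forall m1 m2, b m2 -> b (m1 + m2)%MM.

Lemma monideal_is_ideal b : upclosed b -> is_ideal (monideal b).
Proof.
move=> upb; split=> [m|f g If Ig m|f g Ig m].
- by rewrite msupp0.
- by move/msuppD_le; rewrite mem_cat => /orP[/If|/Ig].
by move/msuppM_le/allpairsP=> [[m1 m2] /= [_ /Ig bm2 ->]]; apply: upb.
Qed.

Lemma monidealZX b c m : b m -> monideal b (c *: 'X_[m]).
Proof. by move=> bm m' /msuppZ_le; rewrite msuppX inE => /eqP ->. Qed.

Lemma monideal_res_split r (x : 'I_n) (bK bJ bI : pred 'X_{1..n}) :
    upclosed bK -> upclosed bJ -> (forall m, bK m -> bJ m) ->
    (forall m, bK (U_(x) + m)%MM -> bK m) ->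
    (forall m, bI m = bK m || (0 < m x)%N && bJ (m - U_(x))%MM) ->
    ideal_res r (monideal bK) -> ideal_res r.+1 (monideal bJ) ->
  ideal_res r.+1 (monideal bI).
Proof.
move=> upK upJ sKJ colK bIE.
have idK := monideal_is_ideal upK; have idJ := monideal_is_ideal upJ.
apply: (@ideal_res_split _ r 'X_x) => //.
- by move=> f Kf m /Kf /sKJ.
- move=> f Kxf m mf; apply: colK; apply: Kxf.
  by rewrite mulrC (perm_mem (msuppMX f U_(x))) map_f.
move=> f; split=> [If|[a Ka [c Jc ->]] m]; last first.
  rewrite bIE => /msuppD_le; rewrite mem_cat => /orP[/Ka -> //|].
  rewrite mulrC (perm_mem (msuppMX c U_(x))) => /mapP[m' /Jc Jm' ->].
  by rewrite mnmDE mnm1E eqxx /= [(U_(x) + m')%MM]addmC addmK Jm' orbT.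
(* Sort the terms of [f]: those in [K] form [a]; each of the others is divisible by ['X_x] with
   quotient in [J]. *)
exists (\sum_(m <- msupp f | bK m) f@_m *: 'X_[m]).
  case: idK => K0 KD _; apply: (big_ind (monideal bK)) => // m.
  exact: monidealZX.
exists (\sum_(m <- msupp f | ~~ bK m) f@_m *: 'X_[m - U_(x)]).
  case: idJ => J0 JD _; rewrite big_seq_cond.
  apply: (big_ind (monideal bJ)) => // m /andP[/If + /negPf nKm].
  by rewrite bIE nKm => /andP[_ Jm]; apply: monidealZX.
rewrite {1}[f]mpolyE (bigID bK) /=; congr (_ + _).
rewrite mulr_sumr big_seq_cond [RHS]big_seq_cond.
apply: eq_bigr => m /andP[/If + /negPf nKm].
rewrite bIE nKm => /andP[mx _]; rewrite -scalerAr -mpolyXD addmC submK //.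
by rewrite lep1mP -lt0n.
Qed.

End MonomialIdeals.

(** * Edge ideals of induced subgraphs, enlarged by variables *)

Section EdgeIdeals.
Variables (k : fieldType) (n : nat) (e : rel 'I_n).
Hypotheses (e_sym : forall u v, e u v = e v u) (e_irr : forall v, ~~ e v v).
Implicit Types (W Y : {set 'I_n}) (m : 'X_{1..n}).

(* Monomials of the ideal generated by the edges inside [W] and the variables
   indexed by [Y]. *)
Definition edge_mon W Y m : bool :=
  [exists i in W, exists j in W, [&& e i j, 0 < m i & 0 < m j]%N]
  || [exists y in Y, 0 < m y]%N.

Lemma edge_monP W Y m :
  reflect ((exists i j, [/\ i \in W, j \in W, e i j, (0 < m i)%N & (0 < m j)%N])
           \/ exists2 y, y \in Y & (0 < m y)%N)
          (edge_mon W Y m).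
Proof.
apply: (iffP orP) => -[].
- by case/exists_inP=> i Wi /exists_inP[j Wj /and3P[]]; left; exists i, j.
- by case/exists_inP=> y Yy my; right; exists y.
- case=> i [j [Wi Wj eij mi mj]]; left; apply/exists_inP; exists i => //.
  by apply/exists_inP; exists j => //; apply/and3P.
by case=> y Yy my; right; apply/exists_inP; exists y.
Qed.

Lemma edge_mon_mono W Y m1 m2 :
    (forall i, i \in W :|: Y -> (0 < m1 i)%N -> (0 < m2 i)%N) ->
  edge_mon W Y m1 -> edge_mon W Y m2.
Proof.
move=> m12 /edge_monP[[i [j [Wi Wj eij mi mj]]]|[y Yy my]]; apply/edge_monP.
  by left; exists i, j; split=> //; apply: m12 => //; rewrite inE ?Wi ?Wj.
by right; exists y => //; apply: m12; rewrite // inE Yy orbT.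
Qed.

Lemma edge_mon_up W Y : upclosed (edge_mon W Y).
Proof.
move=> m1 m2; apply: edge_mon_mono => i _ mi.
by rewrite mnmDE (leq_trans mi) ?leq_addl.
Qed.

(** The variable of [x] occurs in no generator, so cancelling it keeps a monomial in the ideal. *)
Lemma edge_mon_colon W Y x m :
  x \notin W :|: Y -> edge_mon W Y (U_(x) + m)%MM -> edge_mon W Y m.
Proof.
move=> xWY; apply: edge_mon_mono => i WYi; rewrite mnmDE mnm1E.
by case: eqP WYi => // <-; rewrite (negPf xWY).
Qed.

Notation edge_res r W Y := (ideal_res r (monideal (k := k) (edge_mon W Y))).

(** Adding the variable of [x] is the splitting [K + x J] with [J] the unit ideal, hence [predT]. *)
Lemma edge_res_add_var r W Y x : x \notin W :|: Y ->
  edge_res r W Y -> edge_res r.+1 W (x |: Y).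
Proof.
move=> xWY resY; apply: (monideal_res_split (x := x) (bJ := predT)) resY _ => //.
- exact: edge_mon_up.
- by move=> m; apply: edge_mon_colon.
- move=> m; rewrite andbT; apply/edge_monP/orP.
    case=> [[i [j ij]]|[y]]; first by left; apply/edge_monP; left; exists i, j.
    rewrite !inE => /predU1P[-> | Yy] my; first by right.
    by left; apply/edge_monP; right; exists y.
  case=> [/edge_monP[|[y Yy my]]|mx]; first by left.
    by right; exists y; rewrite // inE Yy orbT.
  by right; exists x; rewrite // setU11.
apply: (@free_res_leq _ 1) => //.
by apply: free_res_ext (ideal_res_unit _) => f; split.
Qed.

Lemma edge_res_add_vars r W Y : [disjoint W & Y] ->
  edge_res r W set0 -> edge_res (r + #|Y|) W Y.
Proof.
move=> + resW; move Ec: #|Y| => c; elim: c Y Ec => [|c IHc] Y Ec dWY.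
  by rewrite addn0; move/eqP: Ec; rewrite cards_eq0 => /eqP ->.
have /card_gt0P[x Yx] : (0 < #|Y|)%N by rewrite Ec.
rewrite addnS -(setD1K Yx); apply: edge_res_add_var.
  by rewrite !inE eqxx orbF; move/disjointFl: dWY => ->.
apply: IHc; first by move: Ec; rewrite (cardsD1 x) Yx => -[].
by apply: disjointWr dWY; apply: subD1set.
Qed.

(** In [J] the variables of [N(x)] absorb every edge of [W :\ x] meeting [N(x)]. Only edges outside
    [N[x]] are kept, so the edge part and the added variables involve disjoint vertex sets. *)
Lemma edge_res_step r W x :
    x \in W -> edge_res r (W :\ x) set0 ->
    edge_res r.+1 ([set y in W :\ x | ~~ e x y]) ([set y in W | e x y]) ->
  edge_res r.+1 W set0.
Proof.
move=> Wx; apply: (monideal_res_split (x := x)).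
- exact: edge_mon_up.
- exact: edge_mon_up.
- move=> m /edge_monP[|[y]]; last by rewrite inE.
  case=> i [j [/setD1P[ix Wi] /setD1P[jx Wj] eij mi mj]]; apply/edge_monP.
  have [xi|nxi] := boolP (e x i); first by right; exists i; rewrite // inE Wi.
  have [xj|nxj] := boolP (e x j); first by right; exists j; rewrite // inE Wj.
  by left; exists i, j; rewrite !inE ix jx Wi Wj nxi nxj.
- by move=> m; apply: edge_mon_colon; rewrite !inE eqxx.
move=> m; apply/edge_monP/orP.
  case=> [[i [j [Wi Wj eij mi mj]]]|[y]]; last by rewrite inE.
  have subx (y : 'I_n) : y != x -> (m - U_(x))%MM y = m y.
    by rewrite mnmBE mnm1E eq_sym => /negPf ->; rewrite subn0.
  have [ix|ix] := eqVneq i x.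
    right; rewrite -ix mi; apply/edge_monP; right; exists j; rewrite ?inE ?Wj //.
    (* Without loops the other endpoint differs from [x], so dividing by ['X_x] leaves its exponent
       unchanged. *)
    by rewrite ix subx //; apply: contraL eij => /eqP ->; rewrite ix e_irr.
  have [jx|jx] := eqVneq j x.
    right; rewrite -jx mj; apply/edge_monP; right; exists i.
      by rewrite inE Wi e_sym.
    by rewrite jx subx.
  by left; apply/edge_monP; left; exists i, j; rewrite !inE ix jx.
have lem y : (0 < (m - U_(x))%MM y)%N -> (0 < m y)%N.
  by rewrite mnmBE => /leq_trans; apply; apply: leq_subr.
case=> [/edge_monP[|[y]]|/andP[mx /edge_monP[|[y]]]].
- by case=> i [j [/setD1P[_ Wi] /setD1P[_ Wj] eij mi mj]]; left; exists i, j.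
- by rewrite inE.
- case=> i [j []]; rewrite !inE => /andP[/andP[_ Wi] _] /andP[/andP[_ Wj] _].
  by move=> eij /lem mi /lem mj; left; exists i, j.
by rewrite inE => /andP[Wy exy] /lem my; left; exists x, y.
Qed.

Lemma edge_res_dominated (A : {set 'I_n}) W :
    independent e A -> no_isolated e ->
  exists r (D : {set 'I_n}),
    [/\ (r + #|D| <= #|W|)%N, A :&: W \subset nbhd e D & edge_res r W set0].
Proof.
move=> indA noiso; move Ec: #|W| => c.
elim/ltn_ind: c W Ec => c IHc W Ec.
have [sWA|/subsetPn[x Wx nAx]] := boolP (W \subset A).
  have /fin_all_exists[nb enb] := noiso.
  exists 0%N, (nb @: W); split; first by rewrite -Ec leq_imset_card.
    apply/subsetP=> v /setIP[_ Wv]; rewrite inE; apply/exists_inP.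
    by exists (nb v); rewrite ?imset_f // e_sym.
  move=> f; split=> [If|-> m]; last by rewrite mxE msupp0.
  apply/matrixP=> i j; rewrite !ord1 mxE; apply/eqP; rewrite -msupp_eq0.
  (* A term of [f] would yield an edge inside the independent set [A]. *)
  case Ef: (msupp _) If => [//|m s] /(_ m); rewrite Ef mem_head => /(_ isT).
  case/edge_monP=> [[i' [j' [Wi Wj eij _ _]]]|[y]]; last by rewrite inE.
  move/forall_inP/(_ _ (subsetP sWA _ Wi))/forall_inP: indA.
  by move/(_ _ (subsetP sWA _ Wj)); rewrite eij.
have cW1 : c = #|W :\ x|.+1 by rewrite -Ec (cardsD1 x) Wx.
set N := [set y in W | e x y]; set W2 := [set y in W :\ x | ~~ e x y].
have cW2 : #|W :\ x| = (#|N| + #|W2|)%N.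
  rewrite -(cardsID [set y | e x y] (W :\ x)).
  congr (_ + _)%N; apply: eq_card => y; rewrite !inE; last by rewrite andbC.
  by case: eqP => [->|] //=; rewrite (negPf (e_irr x)) andbF.
have [|r1 [D1 [le1 dom1 res1]]] := IHc #|W :\ x| _ _ erefl; first by rewrite cW1.
have [|r2 [D2 [le2 dom2 res2]]] := IHc #|W2| _ _ erefl.
  by rewrite cW1 cW2 ltnS leq_addl.
have disj : [disjoint W2 & N].
  by apply/pred0P=> y /=; rewrite !inE; case: (e x y); rewrite !(andbF, andFb).
have resN := edge_res_add_vars disj res2.
have domW1 : A :&: W \subset nbhd e D1.
  apply: subset_trans dom1; apply/subsetP=> v /setIP[Av Wv].
  by rewrite !inE Av Wv andbT; apply: contraNneq nAx => <-.
have domW2 : A :&: W \subset nbhd e (x |: D2).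
  apply/subsetP=> v /setIP[Av Wv]; rewrite inE; apply/exists_inP.
  have [xv|nxv] := boolP (e x v); first by exists x; rewrite // setU11.
  have /(subsetP dom2) : v \in A :&: W2.
    by rewrite !inE Av Wv nxv !andbT; apply: contraNneq nAx => <-.
  by rewrite inE => /exists_inP[y Dy eyv]; exists y; rewrite // setU1r.
have cD2 : (#|x |: D2| <= #|D2|.+1)%N by rewrite cardsU1; case: (_ \in _).
(* The length obtained is the maximum of [r1.+1] and [r2 + #|N|]; the branch attaining it supplies
   the dominating set, as both [D1] and [x |: D2] dominate. *)
have [le_r|lt_r] := leqP (r2 + #|N|) r1.+1.
  exists r1.+1, D1; split=> //; first by rewrite cW1 addSn ltnS.
  by apply: edge_res_step Wx res1 _; apply: free_res_leq resN.
exists (r2 + #|N|)%N, (x |: D2); split=> //.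
  rewrite cW1 cW2 (leq_trans (leq_add (leqnn _) cD2)) // addnS ltnS addnAC addnC.
  by rewrite leq_add2l.
(* [edge_res_step] needs a successor; [lt_r] makes this length positive, with predecessor at least
   [r1]. *)
have Er : (r2 + #|N| = (r2 + #|N|).-1.+1)%N by rewrite prednK // (leq_trans _ lt_r).
rewrite Er; apply: edge_res_step Wx _ _; last by rewrite -Er.
by apply: free_res_leq res1; rewrite -ltnS -Er ltnW.
Qed.

Lemma in_edge_idealE (f : {mpoly k[n]}) :
  in_edge_ideal e f <-> monideal (edge_mon setT set0) f.
Proof.
have [I0 ID IM] := monideal_is_ideal k (edge_mon_up (W := setT) (Y := set0)).
split=> [[c ->]|If].
  apply: (big_ind (monideal _)) => // i _; apply: (big_ind (monideal _)) => // j eij.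
  rewrite -mulrA -mpolyXD; apply: IM => m; rewrite msuppX inE => /eqP ->.
  apply/edge_monP; left; exists i, j; split; rewrite ?in_setT //.
    by rewrite mnmDE mnm1E eqxx.
  by rewrite mnmDE [U_(j)%MM j]mnm1E eqxx addn1.
rewrite [f]mpolyE big_seq; apply: (big_ind (@in_edge_ideal k n e)).
- exists (fun _ _ => 0); rewrite big1 // => i _; rewrite big1 // => j _.
  by rewrite !mul0r.
- move=> _ _ [c1 ->] [c2 ->]; exists (fun i j => c1 i j + c2 i j).
  rewrite -big_split; apply: eq_bigr => i _; rewrite -big_split.
  by apply: eq_bigr => j _; rewrite /= !mulrDl.
move=> m /If/edge_monP[[i [j [_ _ eij mi mj]]]|[y]]; last by rewrite inE.
(* Distinct endpoints are needed for divisibility: for [i = j] the exponent would have to be at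
   least 2. *)
have nij : i != j by apply: contraL eij => /eqP ->; apply: e_irr.
have le_ij : (U_(i) + U_(j) <= m)%MM.
  apply/mnm_lepP=> l; rewrite mnmDE !mnm1E.
  have [<-|_] := eqVneq i l; first by rewrite eq_sym (negPf nij).
  by have [<-|_] := eqVneq j l.
exists (fun i' j' => if (i' == i) && (j' == j)
  then f@_m *: 'X_[m - (U_(i) + U_(j))] else 0).
rewrite (bigD1 i) //= (bigD1 j) //= !eqxx /= [X in _ + X]big1 => [|i' /negPf nii]; last first.
  by rewrite big1 // => j' _; rewrite nii !mul0r.
rewrite [X in _ + X + _]big1 => [|j' /andP[_ /negPf njj]]; last by rewrite njj !mul0r.
by rewrite !addr0 -mulrA -mpolyXD -scalerAl -mpolyXD submK.
Qed.

End EdgeIdeals.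

(** * Domination numbers and the final bound *)

Lemma bigminn_le (I : eqType) (s : seq I) (P : pred I) (F : I -> nat) x i :
  i \in s -> P i -> (\big[minn/x]_(j <- s | P j) F j <= F i)%N.
Proof.
move=> + Pi; elim: s => //= j s IHs; rewrite inE big_cons => /predU1P[<-|/IHs le_i].
  by rewrite Pi geq_minl.
by case: ifP => // _; rewrite geq_min le_i orbT.
Qed.

Lemma gamma0_le (n : nat) (e : rel 'I_n) (X D : {set 'I_n}) :
  X \subset nbhd e D -> (gamma0 e X <= #|D|)%N.
Proof. by move=> domX; apply: bigminn_le; rewrite ?mem_index_enum. Qed.

Theorem theorem4p4 (k : fieldType) (n : nat) (e : rel 'I_n) :
  simple_graph e -> no_isolated e ->
  pd_le k e (n - tau e)%N.
Proof.
case=> e_sym e_irr noiso.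
have [A indA tauA] : exists2 A, independent e A & tau e = gamma0 e A.
  (* The empty set is independent, so the maximum defining [tau] is attained. *)
  have [|A indA tauA] := @eq_bigmax_cond _ (independent e) (gamma0 e).
    by apply/card_gt0P; exists set0; apply/forall_inP=> x; rewrite inE.
  by exists A.
have [r [D [le_r dom resT]]] :=
  edge_res_dominated k e_sym e_irr [set: 'I_n] indA noiso.
have le_rn : (r <= n - tau e)%N.
  (* With [W] the whole vertex set, [D] dominates all of [A], so [tau e <= #|D|] while
     [r + #|D| <= n]. *)
  have le_g := gamma0_le dom; rewrite setIT -tauA in le_g.
  rewrite cardsT card_ord in le_r.
  by rewrite -(addnK (tau e) r) leq_sub2r // (leq_trans _ le_r) // leq_add2l.
have [b [d0 [d [b0 im0 ex0 exd]]]] := free_res_chain (free_res_leq le_rn resT).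
exists b, d0, d; split=> // f.
by rewrite in_edge_idealE // -im0 mxE mulr1n.
Qed.
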